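(* Let $\mathcal{A}=\{A_i\}_{i=1}^m$ with $A_i\in\mathbb{R}^{n\times n}$. If all solutions to the exact general joint block diagonalization problem for $\mathcal{A}$ are equivalent, then for almost all $Z\in\mathscr{N}(\mathcal{A})$ one has $\zeta_n^{\mathrm{opt}}(Z)\in\zeta(\mathscr{N}(\mathcal{A}))$.
   Context: A partition of a positive integer $n$ is a tuple $\tau_n=(n_1,\dots,n_t)$ of positive integers with $\sum_i n_i=n$; its cardinality is $\mathrm{card}(\tau_n)=t$. For such a partition, a matrix of order $n$ is $\tau_n$-block diagonal if it has the form $\mathrm{diag}(A_{11},\dots,A_{tt})$ with $A_{jj}$ of order $n_j$. Exact joint block diagonalization (JBD) problem for $\mathcal{A}$ and $\tau_n$: find a nonsingular $W\in\mathbb{R}^{n\times n}$ such that $W^TA_iW$ is $\tau_n$-block diagonal for all $i=1,\dots,m$. Exact general joint block diagonalization problem for $\mathcal{A}$: find a partition $\tau_n'$ of $n$ and a nonsingular $W$ that solves the JBD problem for $\mathcal{A}$ and $\tau_n'$, such that $\mathrm{card}(\tau_n')$ is the maximum of $\mathrm{card}(\tau_n)$ over all partitions $\tau_n$ of $n$ for which the JBD problem for $\mathcal{A}$ and $\tau_n$ has a solution. Such a pair $(\tau_n',W)$ is called a solution. Equivalence of solutions: $(\tau_n,W)$ with $\tau_n=(n_1,\dots,n_t)$ and $(\hat\tau_n,\widehat W)$ are equivalent if $(\hat\tau_n,\widehat W)=(\tau_n\Pi_t,\,WT\Pi)$ for some permutation matrix $\Pi_t$ of order $t$ and some nonsingular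 $\tau_n$-block diagonal matrix $T$. Here $\tau_n$ is regarded as a row vector, and $\Pi\in\mathbb{R}^{n\times n}$ is the block permutation matrix obtained from $\Pi_t$ by replacing, in its $j$-th row, the entry 1 by $I_{n_j}$ and the entries 0 by zero matrices of the appropriate sizes. The null space of $\mathcal{A}$ is $\mathscr{N}(\mathcal{A})=\{Z\in\mathbb{R}^{n\times n} : A_iZ=Z^TA_i,\ i=1,\dots,m\}$, a finite-dimensional real vector space; ''almost all'' is with respect to Lebesgue measure on this space. Optimal eigenvalue partition: for $Z\in\mathbb{R}^{n\times n}$, group the distinct (complex) eigenvalues of $Z$ into subsets, each being either a single real eigenvalue or a single pair $\{\lambda,\bar\lambda\}$ of non-real conjugate eigenvalues; $\zeta_n^{\mathrm{opt}}(Z)$ is the partition of $n$ whose parts are the sums of the algebraic multiplicities of the eigenvalues in each subset. It is unique up to permutation of its parts, and its cardinality is the number of subsets. $\zeta(\mathscr{N}(\mathcal{A}))$ denotes the set of all $\zeta_n^{\mathrm{opt}}(Z)$ (in any order of the parts), where $Z$ ranges over the elements of $\mathscr{N}(\mathcal{A})$ at which $\mathrm{card}(\zeta_n^{\mathrm{opt}}(Z))$ attains its maximum over $\mathscr{N}(\mathcal{A})$. *)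

(* Defs.v *)
From HB Require Import structures.
From mathcomp Require Import all_boot all_order all_algebra all_fingroup.
From mathcomp Require Import complex.
From mathcomp Require Import all_classical all_reals all_analysis.

Set Implicit Arguments.
Unset Strict Implicit.
Unset Printing Implicit Defensive.

Import Order.TTheory GRing.Theory Num.Theory.
Import numFieldNormedType.Exports.

Local Open Scope classical_set_scope.
Local Open Scope ring_scope.

Definition is_partition (n : nat) (tau : seq nat) : Prop :=
  all (leq 1) tau /\ sumn tau = n.

(* For tau = (n_1, ..., n_t), the row (or column) index i < n lies in the
   block of (0-based) number [reshape_index tau i], at position
   [reshape_offset tau i] inside that block. *)
Definition block_diagonal (R : realType) (n : nat) (tau : seq nat)
    (M : 'M[R]_n) : Prop :=
  forall i j : 'I_n, reshape_index tau i != reshape_index tau j -> M i j = 0.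

Definition jbd_solution (R : realType) (m n : nat) (A : 'I_m -> 'M[R]_n)
    (tau : seq nat) (W : 'M[R]_n) : Prop :=
  W \in unitmx /\ forall i, block_diagonal tau (W^T *m A i *m W).

Definition gjbd_solution (R : realType) (m n : nat) (A : 'I_m -> 'M[R]_n)
    (tau : seq nat) (W : 'M[R]_n) : Prop :=
  [/\ is_partition n tau,
      jbd_solution A tau W
    & forall (tau' : seq nat) (W' : 'M[R]_n), is_partition n tau' ->
        jbd_solution A tau' W' -> (size tau' <= size tau)%N].

(* A permutation matrix of order t is [perm_mx s] with s : 'S_t; its entry
   (i, j) is 1 iff s i = j, so that (tau *m perm_mx s) has j-th entry
   tau_(s^-1 j). *)
Definition perm_partition (tau : seq nat) (s : 'S_(size tau)) : seq nat :=
  [seq nth 0%N tau ((s^-1)%g j) | j : 'I_(size tau)].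

(* The matrix obtained from [perm_mx s] by replacing the entry 1 of its k-th
   row by the identity of order tau_k and the zeros by zero blocks: block rows
   are sized by tau and block columns by [perm_partition s]. *)
Definition block_perm_mx (R : realType) (n : nat) (tau : seq nat)
    (s : 'S_(size tau)) : 'M[R]_n :=
  \matrix_(i, j)
    [exists k : 'I_(size tau),
      [&& reshape_index tau i == k,
          reshape_index (perm_partition s) j == s k
        & reshape_offset tau i == reshape_offset (perm_partition s) j]]%:R.

Definition equivalent_solutions (R : realType) (n : nat)
    (tau : seq nat) (W : 'M[R]_n) (tau' : seq nat) (W' : 'M[R]_n) : Prop :=
  exists (s : 'S_(size tau)) (T : 'M[R]_n),
    [/\ T \in unitmx, block_diagonal tau T,
        tau' = perm_partition s
      & W' = W *m T *m block_perm_mx R n s].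

Section NullSpace.
Context (R : realType) (m n : nat) (A : 'I_m -> 'M[R]_n).

Definition null_map (i : 'I_m) (Z : 'M[R]_n) : 'M[R]_n :=
  A i *m Z - Z^T *m A i.

Fact null_map_is_linear (i : 'I_m) : linear (null_map i).
Proof.
move=> a Y Z; rewrite /null_map linearP /= linearP /= mulmxDl -scalemxAl.
by rewrite scalerBr opprD addrACA.
Qed.

HB.instance Definition _ (i : 'I_m) :=
  GRing.isLinear.Build R 'M[R]_n 'M[R]_n *:%R (null_map i)
    (null_map_is_linear i).

Definition null_space : {vspace 'M[R]_n} :=
  (\bigcap_(i < m) lker (linfun (null_map i)))%VS.

Lemma null_spaceP (Z : 'M[R]_n) :
  reflect (forall i, A i *m Z = Z^T *m A i) (Z \in null_space).
Proof.
apply: (iffP idP) => [/subv_bigcapP ZN i|ZN].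
  have := ZN i isT; rewrite -memvE memv_ker lfunE /= /null_map subr_eq0.
  by move/eqP.
apply/subv_bigcapP => i _; rewrite -memvE memv_ker lfunE /= /null_map.
by rewrite ZN subrr.
Qed.

End NullSpace.

Section OptimalEigenvaluePartition.
Context (R : realType) (n : nat) (Z : 'M[R]_n).

Definition complex_mx : 'M[R[i]]_n := map_mx (real_complex R) Z.

Definition eigenvalues : seq R[i] :=
  undup (sval (closed_field_poly_normal (char_poly complex_mx))).

(* A pair of non-real conjugate eigenvalues is represented by its member of
   positive imaginary part. *)
Definition eigenvalue_groups : seq (seq R[i]) :=
  [seq (if complex.Im l == 0 then [:: l] else [:: l; conjc l])
     | l <- eigenvalues & 0 <= complex.Im l].

Definition zeta_opt : seq nat :=
  [seq (\sum_(l <- g) mup l (char_poly complex_mx))%N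
     | g <- eigenvalue_groups].

Lemma mem_eigenvalues (l : R[i]) :
  (l \in eigenvalues) = eigenvalue complex_mx l.
Proof.
rewrite mem_undup eigenvalue_root_char; case: closed_field_poly_normal => /= r.
by rewrite (monicP (char_poly_monic _)) scale1r => ->; rewrite root_prod_XsubC.
Qed.

Lemma conj_eigenvalues (l : R[i]) :
  (conjc l \in eigenvalues) = (l \in eigenvalues).
Proof.
rewrite !mem_eigenvalues !eigenvalue_root_char.
have cC : map_poly (conjc (R := R)) (char_poly complex_mx)
          = char_poly complex_mx.
  rewrite map_char_poly -map_mx_comp; congr char_poly; apply/matrixP => i j.
  by rewrite !mxE /= /conjc /= oppr0.
by rewrite -[in LHS]cC fmorph_root.
Qed.

End OptimalEigenvaluePartition.

Section EigenvaluePartitionTheory.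
Context (R : realType) (n : nat) (Z : 'M[R]_n).

Let group (l : R[i]) : seq R[i] :=
  if complex.Im l == 0 then [:: l] else [:: l; conjc l].

Let mem_group (k l : R[i]) : (k \in group l) = (k == l) || (k == conjc l).
Proof.
case: l => c d; rewrite /group /=; case: eqP => [->|_]; rewrite !inE//=.
by rewrite oppr0 orbb.
Qed.

Let uniq_groups (s : seq R[i]) : uniq s ->
  (forall l, l \in s -> 0 <= complex.Im l) -> uniq (flatten (map group s)).
Proof.
elim: s => //= l s IHs /andP[ls us] sP; rewrite cat_uniq; apply/and3P; split.
- rewrite /group; case: ifP => //= l0; rewrite inE andbT.
  case: l {ls sP} l0 => a b /= /negbT b0; rewrite eq_complex /= eqxx /=.
  by rewrite -addr_eq0 -mulr2n mulrn_eq0 /= (negPf b0).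
- apply/hasPn => k /flatten_mapP[j js]; rewrite !mem_group => kj.
  apply/negP => kl.
  have lj : l != j by apply: contraNneq ls => ->.
  have l0 : 0 <= complex.Im l by apply: sP; rewrite inE eqxx.
  have j0 : 0 <= complex.Im j by apply: sP; rewrite inE js orbT.
  case: l j k lj l0 j0 kj kl {ls js sP} => [a b] [c d] [u v] /=.
  rewrite !eq_complex /= => lj b0 d0 kj kl.
  have [uc ua] : u = c /\ u = a.
    by split; [case/orP: kj | case/orP: kl] => /andP[/eqP].
  move: lj; rewrite -uc -ua eqxx /=; move: kj kl.
  rewrite -uc -ua eqxx /= => kj kl.
  have vd : `|v| = d.
    by case/orP: kj => /eqP->; rewrite ?normrN ger0_norm.
  have vb : `|v| = b.
    by case/orP: kl => /eqP->; rewrite ?normrN ger0_norm.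
  by rewrite -vd -vb eqxx.
- by apply: IHs => // k ks; apply: sP; rewrite inE ks orbT.
Qed.

Lemma perm_eigenvalue_groups :
  perm_eq (flatten (eigenvalue_groups Z)) (eigenvalues Z).
Proof.
apply: uniq_perm; last 1 first.
- move=> k; apply/flatten_mapP/idP => [[l]|kZ].
    rewrite mem_filter => /andP[_ lZ]; rewrite -/(group l) mem_group.
    by case/orP => /eqP->; rewrite ?conj_eigenvalues.
  case: (leP 0 (complex.Im k)) => k0; [exists k|exists (conjc k)];
    rewrite ?mem_filter ?conj_eigenvalues ?k0 ?kZ //.
  + by rewrite -/(group k) mem_group eqxx.
  + by rewrite andbT; case: k k0 {kZ} => a b /= b0; rewrite oppr_ge0 ltW.
  + by rewrite -/(group (conjc k)) mem_group conjcK eqxx orbT.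
- apply: uniq_groups; first by rewrite filter_uniq// undup_uniq.
  by move=> l; rewrite mem_filter => /andP[].
- exact: undup_uniq.
Qed.

Lemma zeta_opt_partition : is_partition n (zeta_opt Z).
Proof.
have chZ : char_poly (complex_mx Z) != 0 by rewrite monic_neq0 ?char_poly_monic.
split.
- apply/allP => k /mapP[g gZ ->].
  have [l lZ lg] : exists2 l, l \in eigenvalues Z & l \in g.
    move: gZ => /mapP[l]; rewrite mem_filter => /andP[_ lZ] ->.
    by exists l => //; rewrite -/(group l) mem_group eqxx.
  rewrite (big_rem l lg)/= ltn_addr// mup_geq// expr1 dvdp_XsubCl.
  by rewrite -eigenvalue_root_char -mem_eigenvalues.
- rewrite sumnE big_map -big_flatten/= (perm_big _ perm_eigenvalue_groups)/=.
  rewrite /eigenvalues; case: closed_field_poly_normal => r /=.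
  rewrite (monicP (char_poly_monic _)) scale1r => rE.
  under eq_bigr do rewrite [in mup _ _]rE mu_prod_XsubC.
  have /(congr1 (fun p : {poly R[i]} => size p)) := rE.
  rewrite size_char_poly size_prod_XsubC => -[->].
  rewrite -(perm_size (perm_count_undup r)) size_flatten /shape -map_comp.
  by rewrite sumnE big_map; apply: eq_bigr => l _ /=; rewrite size_nseq.
Qed.

End EigenvaluePartitionTheory.

(* The maximum of card(zeta_opt) is taken over the null space, and the parts of
   a partition may be listed in any order. *)
Definition zeta_null_space (R : realType) (m n : nat) (A : 'I_m -> 'M[R]_n) :
    set (seq nat) :=
  [set tau | exists2 Z, Z \in null_space A &
     (forall Z', Z' \in null_space A ->
        (size (zeta_opt Z') <= size (zeta_opt Z))%N)
     /\ perm_eq tau (zeta_opt Z)].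

Section PowerMeasure.
Local Open Scope ereal_scope.
Context d (T : measurableType d) (R : realType)
  (mu : {sigma_finite_measure set T -> \bar R}).

Definition tuple_cons (k : nat) (p : T * k.-tuple T) : k.+1.-tuple T :=
  [tuple of p.1 :: p.2].

Definition tuple_uncons (k : nat) (t : k.+1.-tuple T) : T * k.-tuple T :=
  (thead t, [tuple of behead t]).

Lemma tuple_consK (k : nat) : cancel (@tuple_cons k) (@tuple_uncons k).
Proof.
by move=> [x t]; rewrite /tuple_uncons theadE; congr pair; apply: val_inj.
Qed.

Lemma measurable_tuple_cons (k : nat) :
  measurable_fun [set: T * k.-tuple T] (@tuple_cons k).
Proof. exact: measurable_cons. Qed.

Lemma measurable_tuple_uncons (k : nat) :
  measurable_fun [set: k.+1.-tuple T] (@tuple_uncons k).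
Proof.
apply: measurable_fun_pair; first exact: measurable_tnth.
exact: measurable_behead.
Qed.

Section Step.
Context (k : nat) (nu : {sigma_finite_measure set (k.-tuple T) -> \bar R}).

Definition measure_cons : set (k.+1.-tuple T) -> \bar R :=
  pushforward (mu \x nu) (@tuple_cons k).

Let preimage_cons A : measurable A -> measurable (@tuple_cons k @^-1` A).
Proof.
by move=> mA; rewrite -[X in measurable X]setTI; exact: measurable_tuple_cons.
Qed.

Let measure_cons0 : measure_cons set0 = 0.
Proof. by rewrite /measure_cons /pushforward preimage_set0 measure0. Qed.

Let measure_cons_ge0 A : 0 <= measure_cons A.
Proof. by rewrite /measure_cons /pushforward; exact: integral_ge0. Qed.

Let measure_cons_sigma_additive : semi_sigma_additive measure_cons.
Proof.
move=> F mF tF mUF; rewrite /measure_cons /pushforward preimage_bigcup.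
apply: measure_semi_sigma_additive.
- by move=> j; exact: preimage_cons.
- apply/trivIsetP => /= i j _ _ ij; rewrite -preimage_setI.
  by move/trivIsetP : tF => /(_ _ _ _ _ ij) ->//; rewrite preimage_set0.
- by rewrite -preimage_bigcup; exact: preimage_cons.
Qed.

HB.instance Definition _ := isMeasure.Build _ _ _ measure_cons
  measure_cons0 measure_cons_ge0 measure_cons_sigma_additive.

Lemma measure_consE (A : set T) (B : set (k.-tuple T)) :
  measurable A -> measurable B ->
  measure_cons (@tuple_uncons k @^-1` (A `*` B)) = mu A * nu B.
Proof.
move=> mA mB; rewrite -product_measure1E//.
rewrite /measure_cons /pushforward -comp_preimage.
rewrite (_ : _ \o _ = id) ?preimage_id//.
by apply/funext => p /=; rewrite tuple_consK.
Qed.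

Let measure_cons_sigma_finite : sigma_finite setT measure_cons.
Proof.
have /sigma_finiteP[F [FT ndF Foo]] := sigma_finiteT mu.
have /sigma_finiteP[G [GT ndG Goo]] := sigma_finiteT nu.
exists (fun j => @tuple_uncons k @^-1` (F j `*` G j)).
  apply/esym; rewrite -subTset => t _; case tE : (tuple_uncons t) => [x u].
  have [i _ Fx] : (\bigcup_i F i) x by rewrite -FT.
  have [j _ Gu] : (\bigcup_i G i) u by rewrite -GT.
  exists (maxn i j) => //.
  rewrite /preimage /mkset tE; split => /=.
    by move: Fx; exact/subsetPset/ndF/leq_maxl.
  by move: Gu; exact/subsetPset/ndG/leq_maxr.
move=> j; have [mF Fj] := Foo j; have [mG Gj] := Goo j; split.
  rewrite -[X in measurable X]setTI.
  by apply: measurable_tuple_uncons => //; exact: measurableX.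
by rewrite measure_consE// lte_mul_pinfty// ge0_fin_numE.
Qed.

HB.instance Definition _ := @Measure_isSigmaFinite.Build _ _ _
  measure_cons measure_cons_sigma_finite.

End Step.

(* The k-fold product measure, characterised by [power_measure_box]. *)
Fixpoint power_measure (k : nat) :
    {sigma_finite_measure set (k.-tuple T) -> \bar R} :=
  match k with
  | 0 => \d_([tuple] : 0.-tuple T)
  | k'.+1 => measure_cons (power_measure k')
  end.

Lemma power_measure_box (k : nat) (D : 'I_k -> set T) :
  (forall i, measurable (D i)) ->
  power_measure k [set x | forall i, D i (tnth x i)]
  = \prod_(i < k) mu (D i).
Proof.
have mbox j (E : 'I_j -> set T) : (forall i, measurable (E i)) ->
    measurable [set x : j.-tuple T | forall i, E i (tnth x i)].
  move=> mE; rewrite (_ : mkset _ = \bigcap_i ((fun x => tnth x i) @^-1` E i)).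
    apply: fin_bigcap_measurable => // i _.
    by rewrite -[X in measurable X]setTI; exact: measurable_tnth.
  by apply/seteqP; split => x /= xE i => [_|]; exact: xE.
elim: k D => [|k IHk] D mD.
  rewrite big_ord0 /= diracE mem_set// => i; by case: i.
rewrite big_ord_recl -(IHk (fun i => D (lift ord0 i)))//.
rewrite /= -measure_consE//; last exact: (mbox k (fun i => D (lift ord0 i))).
congr measure_cons; apply/seteqP; split => x /=.
  move=> xD; split; first exact: xD.
  move=> i; have := xD (lift ord0 i); rewrite [in tnth x _](tuple_eta x) tnthS.
  by [].
move=> [x0 xD] i; case: (unliftP ord0 i) => [j ->|->] //.
rewrite [in tnth x _](tuple_eta x) tnthS; exact: xD.
Qed.

End PowerMeasure.

Definition lebesgue_tuple (R : realType) (k : nat) :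
    {sigma_finite_measure set (k.-tuple (measurableTypeR R)) -> \bar R} :=
  power_measure (@lebesgue_measure R) k.

(* Lebesgue measure on V is transported from coordinates in a basis; changing
   the basis only rescales it, so its null sets do not depend on the basis. *)
Definition ae_vspace (R : realType) (E : vectType R) (V : {vspace E})
    (P : E -> Prop) : Prop :=
  forall b : (\dim V).-tuple E, basis_of V b ->
    {ae lebesgue_tuple R (\dim V), forall x, P (\sum_i tnth x i *: tnth b i)}.

(* Main.v *)
Require Import Defs.
From HB Require Import structures.
From mathcomp Require Import all_boot all_order all_algebra all_fingroup.
From mathcomp Require Import complex ring.
From mathcomp Require Import all_classical all_reals all_analysis.

(** Fix a solution (tau, W) with tau of maximal cardinality t.  Interpolating
    at the eigenvalue groups of Z in N(A) gives a real polynomial f with f(Z)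
    diagonalizable over R and one eigenvalue per group; as f(Z) is in N(A), an
    eigenbasis of f(Z) block diagonalizes A, so Z has at most t groups.

    Uniqueness forces W^-1 Z W to be tau-block diagonal for every Z in N(A):
    the commutator of two elements of N(A) is skew for A, and its Cayley
    transform carries a solution to a solution.

    Hence each diagonal block of W^-1 Z W can be altered separately inside N(A),
    and the bound t shows that all its eigenvalues have the same real part,
    which is the mean of its diagonal entries.  So Z has t groups as soon as the
    t block means differ, which excludes only finitely many proper hyperplanes
    of N(A). *)

Set Implicit Arguments.
Unset Strict Implicit.
Unset Printing Implicit Defensive.

Import Order.TTheory GRing.Theory Num.Theory.
Import numFieldNormedType.Exports.

Local Open Scope ring_scope.

(** * Cayley transforms preserving a bilinear form *)

Lemma poly_nonroot (F : numFieldType) (p : {poly F}) :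
  p != 0 -> exists x, p.[x] != 0.
Proof.
move=> p0; apply/not_existsP => proot.
suff : (size [seq i%:R : F | i <- iota 0 (size p)] < size p)%N.
  by rewrite size_map size_iota ltnn.
apply: max_poly_roots => //.
  apply/allP => x _; by have /negP/negPn := proot x.
by rewrite map_inj_uniq ?iota_uniq// => i j /eqP; rewrite eqr_nat => /eqP.
Qed.

Definition cayley_mx (F : fieldType) (n : nat) (K : 'M[F]_n) : 'M[F]_n :=
  (1%:M + K) *m invmx (1%:M - K).

(* All the conditions are polynomial in the parameter and hold at 0. *)
Lemma cayley_mx_diag_neq0 (F : numFieldType) (n : nat) (K : 'M[F]_n) :
  exists e, [/\ e != 0, 1%:M - e *: K \in unitmx,
    1%:M + e *: K \in unitmx & forall a, cayley_mx (e *: K) a a != 0].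
Proof.
pose Kp : 'M[{poly F}]_n := map_mx polyC K.
pose N : 'M[{poly F}]_n := 1%:M - 'X *: Kp.
(* The adjugate replaces the inverse to keep the entries polynomial; where [\det N] is nonzero, [M]
   is the Cayley transform times that scalar. *)
pose M : 'M[{poly F}]_n := (1%:M + 'X *: Kp) *m \adj N.
pose p := \det N * \det (1%:M + 'X *: Kp) * \prod_a M a a.
have evK x : map_mx (horner_eval x) ('X *: Kp) = x *: K.
  by apply/matrixP => i j; rewrite !mxE /horner_eval hornerM hornerX hornerC.
have evN x : map_mx (horner_eval x) N = 1%:M - x *: K.
  by rewrite map_mxB map_mx1 evK.
have evM x : map_mx (horner_eval x) M = (1%:M + x *: K) *m \adj (1%:M - x *: K).
  by rewrite map_mxM map_mxD map_mx1 evK map_mx_adj evN.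
have evdet x : (\det N).[x] = \det (1%:M - x *: K).
  by rewrite -evN det_map_mx.
have evdet' x : (\det (1%:M + 'X *: Kp)).[x] = \det (1%:M + x *: K).
  by rewrite -evK -[in RHS](map_mx1 (horner_eval x)) -map_mxD det_map_mx.
have evp x : p.[x] = \det (1%:M - x *: K) * \det (1%:M + x *: K) *
    \prod_a ((1%:M + x *: K) *m \adj (1%:M - x *: K)) a a.
  rewrite !hornerM evdet evdet' horner_prod -evM; congr (_ * _).
  by apply: eq_bigr => a _; rewrite [in RHS]mxE.
have p0 : p.[0] = 1.
  rewrite evp scale0r subr0 addr0 det1 mul1mx !mul1r.
  have -> : \adj (1%:M : 'M[F]_n) = 1%:M.
    by rewrite -[LHS]mul1mx mul_mx_adj det1.
  by rewrite big1// => a _; rewrite mxE eqxx.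
(* The factor ['X] makes the point obtained below nonzero. *)
have pX0 : p * 'X != 0.
  by rewrite mulf_neq0 ?polyX_eq0//; apply: contra_eq_neq p0 => ->;
    rewrite horner0 eq_sym oner_neq0.
have [e] := poly_nonroot pX0.
rewrite hornerM hornerX mulf_eq0 negb_or evp !mulf_eq0 !negb_or.
move=> /andP[/andP[/andP[det0 det0'] /prodf_neq0 diag0] e0].
have unitN : 1%:M - e *: K \in unitmx by rewrite unitmxE unitfE.
exists e; split=> // [|a]; first by rewrite unitmxE unitfE.
have := diag0 a isT; apply: contra_neq => Ga.
rewrite /cayley_mx /invmx unitN -scalemxAr mxE in Ga.
by move/eqP: Ga; rewrite mulf_eq0 invr_eq0 (negPf det0) => /eqP.
Qed.

(** Skewness carries each of [1%:M + K] and [1%:M - K] across [B] into the transpose of the other.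
    As the two commute, they act on [B] by the same congruence. *)
Lemma cayley_mx_adjoint (F : fieldType) (n : nat) (B K : 'M[F]_n) :
  1%:M - K \in unitmx -> B *m K = - (K^T *m B) ->
  (cayley_mx K)^T *m B *m cayley_mx K = B.
Proof.
move=> uK BK; rewrite /cayley_mx trmx_mul trmx_inv.
have BD : B *m (1%:M + K) = (1%:M - K)^T *m B.
  by rewrite mulmxDr mulmx1 BK linearB /= trmx1 mulmxBl mul1mx.
have DB : (1%:M + K)^T *m B = B *m (1%:M - K).
  by rewrite linearD /= trmx1 mulmxDl mul1mx mulmxBr mulmx1 BK opprK.
have E : (1%:M + K)^T *m B *m (1%:M + K) = (1%:M - K)^T *m B *m (1%:M - K).
  rewrite -mulmxA BD -[in RHS]mulmxA -DB !mulmxA -!trmx_mul; congr (_^T *m _).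
  rewrite mulmxBl mulmxDl !mul1mx mulmxDr mulmxBr !mulmx1.
  by rewrite opprD !addrA addrK addrNK.
transitivity (invmx (1%:M - K)^T *m ((1%:M + K)^T *m B *m (1%:M + K))
              *m invmx (1%:M - K)); first by rewrite !mulmxA.
by rewrite E !mulmxA mulVmx ?unitmx_tr// mul1mx mulmxK.
Qed.

(** * Block diagonality and equivalence *)

Definition block_scalar_mx (R : realType) (n : nat) (tau : seq nat)
    (g : nat -> R) : 'M[R]_n :=
  diag_mx (\row_a g (reshape_index tau a)).

Lemma block_diagonal_scalarC (R : realType) (n : nat) (tau : seq nat)
    (g : nat -> R) (M : 'M[R]_n) :
  block_diagonal tau M -> comm_mx M (block_scalar_mx n tau g).
Proof.
move=> bM; apply/matrixP => a b; rewrite mul_mx_diag mul_diag_mx !mxE.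
have [->|/bM->] := eqVneq (reshape_index tau a) (reshape_index tau b).
  by rewrite mulrC.
by rewrite mul0r mulr0.
Qed.

(** Distinct block numbers stay distinct in [R], so one commutation relation detects every entry
    between different blocks. *)
Lemma block_diagonal_indexP (R : realType) (n : nat) (tau : seq nat)
    (M : 'M[R]_n) :
  block_diagonal tau M <-> comm_mx M (block_scalar_mx n tau (fun k => k%:R)).
Proof.
split=> [|/matrixP cM a b]; first exact: block_diagonal_scalarC.
apply: contraNeq => Mab; have := cM a b.
rewrite mul_mx_diag mul_diag_mx !mxE mulrC => /(mulIf Mab)/eqP.
by rewrite eqr_nat eq_sym.
Qed.

(** The nonzero entries of [T *m P] in block row [k] lie in block column [s k]; the nonzero diagonal
    of [G] thus forces [s] to fix every block number that occurs. *)
Lemma equivalent_block_diagonal (R : realType) (n : nat) (tau : seq nat)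
    (W G : 'M[R]_n) : W \in unitmx ->
  equivalent_solutions tau W tau (W *m G) -> (forall a, G a a != 0) ->
  block_diagonal tau G.
Proof.
move=> uW [s [T [_ bT taus]]]; rewrite -mulmxA => /(can_inj (mulKmx uW)) ->.
set P := block_perm_mx _ _ _ => TP0.
have TP a b : (T *m P) a b != 0 ->
    exists2 k : 'I_(size tau),
      reshape_index tau a = k & reshape_index tau b = s k.
  move=> TPab; have /existsP[c] : [exists c, T a c * P c b != 0].
    apply: contra_neqT TPab => /existsPn Tc; rewrite mxE big1// => c _.
    exact/eqP/negPn/Tc.
  rewrite mulf_eq0 negb_or => /andP[Tac].
  rewrite mxE -taus.
  case: existsP => [[k /and3P[/eqP ck /eqP bk _]] _|]; last by rewrite eqxx.
  exists k => //; rewrite -ck; apply/eqP; apply: contraNT Tac => /bT ->.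
  by rewrite eqxx.
move=> a b ab; case: (eqVneq ((T *m P) a b) 0) => // /TP[k ak bk].
have [k' ak' sk'] := TP _ _ (TP0 a).
have kk' : k = k' by apply: ord_inj; rewrite -ak -ak'.
by move: ab; rewrite bk kk' -sk' eqxx.
Qed.

Lemma reshape_index_lt (n : nat) (tau : seq nat) (a : 'I_n) :
  is_partition n tau -> (reshape_index tau a < size tau)%N.
Proof. by move=> [_ taun]; rewrite reshape_indexP// taun. Qed.

Lemma reshape_index_onto (n : nat) (tau : seq nat) (j : 'I_(size tau)) :
  is_partition n tau -> exists a : 'I_n, reshape_index tau a = j.
Proof.
move=> [/all_nthP tau1 taun].
have tauj := tau1 0%N j (ltn_ord j).
have an : (flatten_index tau j 0 < n)%N by rewrite -taun flatten_indexP.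
by exists (Ordinal an); rewrite /= flatten_indexKl.
Qed.

Lemma is_partition_size (n : nat) (tau : seq nat) :
  is_partition n tau -> (size tau <= n)%N.
Proof.
move=> [+ <-]; elim: tau => //= k tau IHtau /andP[k1 tau1].
by rewrite -add1n leq_add// IHtau.
Qed.

(** The uniqueness hypothesis provides no solution to start from. The identity solves the one-part
    problem, and no partition has more than [n] parts. *)
Lemma gjbd_solution_exists (R : realType) (m n : nat) (A : 'I_m -> 'M[R]_n) :
  (0 < n)%N -> exists tau W, gjbd_solution A tau W.
Proof.
move=> n0.
pose P t := `[< exists tau W,
  [/\ is_partition n tau, jbd_solution A tau W & size tau = t] >].
have exP : exists t, P t.
  exists 1%N; apply/asboolP; exists [:: n], 1%:M; split=> //.
    by split; rewrite /= ?n0 ?addn0.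
  split; first exact: unitmx1.
  move=> i a b.
  have part : is_partition n [:: n] by split; rewrite /= ?n0 ?addn0.
  have /= := reshape_index_lt a part; have /= := reshape_index_lt b part.
  by rewrite !ltnS !leqn0 => /eqP-> /eqP->; rewrite eqxx.
have leP t : P t -> (t <= n)%N.
  by move=> /asboolP[tau [W [ptau _ <-]]]; exact: is_partition_size.
case: (ex_maxnP exP leP) => t /asboolP[tau [W [ptau sol <-]]] max.
exists tau, W; split=> // tau' W' ptau' sol'; apply: max; apply/asboolP.
by exists tau', W'.
Qed.

(** * Null space elements in block coordinates *)

Lemma null_space_conj (R : realType) (n : nat) (A Z W : 'M[R]_n) :
  W \in unitmx -> A *m Z = Z^T *m A ->
  W^T *m A *m W *m (invmx W *m Z *m W) =
    (invmx W *m Z *m W)^T *m (W^T *m A *m W).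
Proof.
move=> uW AZ; rewrite !trmx_mul trmx_inv !mulmxA mulmxK// mulmxKV ?unitmx_tr//.
by rewrite -!mulmxA; congr (_ *m _); rewrite !mulmxA AZ.
Qed.

(* The commutator K of Z with the matrix of block indices is skew for every A_i,
   so its Cayley transform is a symmetry of the problem and yields another
   solution with the same partition.  By uniqueness that symmetry is block
   diagonal, hence so are K and Z. *)
Lemma null_space_block_diagonal (R : realType) (m n : nat)
    (A : 'I_m -> 'M[R]_n) (tau : seq nat) (W Z : 'M[R]_n) :
  (forall W' : 'M[R]_n, gjbd_solution A tau W' ->
     equivalent_solutions tau W tau W') ->
  gjbd_solution A tau W -> Z \in null_space A ->
  block_diagonal tau (invmx W *m Z *m W).
Proof.
move=> equivW [ptau [uW bW] max] /null_spaceP AZ.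
set X := invmx W *m Z *m W; pose D := block_scalar_mx n tau (fun k => k%:R : R).
have AX i : W^T *m A i *m W *m X = X^T *m (W^T *m A i *m W).
  exact: null_space_conj.
clearbody X.
have trD : D^T = D by rewrite tr_diag_mx.
pose K := D *m X - X *m D.
have AK i : W^T *m A i *m W *m K = - (K^T *m (W^T *m A i *m W)).
  have /block_diagonal_indexP := bW i; rewrite /comm_mx -/D.
  move: (AX i); move: (W^T *m A i *m W) => B BX BD.
  rewrite mulmxBr !mulmxA BD BX -!mulmxA BX BD.
  by rewrite linearB /= !trmx_mul trD mulmxBl opprB !mulmxA.
have [e [e0 uN uP diag0]] := cayley_mx_diag_neq0 K.
set G := cayley_mx (e *: K) in diag0.
have bG : block_diagonal tau G.
  apply: (equivalent_block_diagonal uW _ diag0); apply: equivW; split=> //.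
  split=> [|i]; first by rewrite !unitmx_mul uW uP unitmx_inv.
  have -> : (W *m G)^T *m A i *m (W *m G) = G^T *m (W^T *m A i *m W) *m G.
    by rewrite trmx_mul !mulmxA.
  rewrite cayley_mx_adjoint//.
  by rewrite -scalemxAr AK scalerN [in RHS]linearZ /= scalemxAl.
have /block_diagonal_indexP := bG; rewrite /comm_mx -/D => GD.
(* Thus [1%:M - e *: K] is twice the inverse of [1%:M + G] and commutes with [D] because [G]
   does. *)
have GN : (1%:M + G) *m (1%:M - e *: K) = 2%:M.
  by rewrite mulmxDl mul1mx mulmxKV// addrACA addNr addr0 -raddfD.
have NG : (1%:M - e *: K) *m (1%:M + G) = 2%:M.
  have half : (2^-1 *: (1%:M + G)) *m (1%:M - e *: K) = 1%:M.
    by rewrite -scalemxAl GN -scalemx1 scalerA mulVf ?scale1r ?pnatr_eq0.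
  have /(congr1 ( *:%R 2)) := mulmx1C half.
  by rewrite -scalemxAr scalerA divff ?scale1r ?scalemx1 ?pnatr_eq0.
have comN : (1%:M - e *: K) *m D = D *m (1%:M - e *: K).
  have two : 2%:M *m ((1%:M - e *: K) *m D) = 2%:M *m (D *m (1%:M - e *: K)).
    rewrite -[LHS]scalar_mxC -{1}GN -NG !mulmxA.
    congr (_ *m _); rewrite -!mulmxA; congr (_ *m _).
    by rewrite mulmxDr mulmxDl mul1mx mulmx1 GD.
  by rewrite !mul_scalar_mx in two; apply: (scalerI _ two); rewrite pnatr_eq0.
have KD : K *m D = D *m K.
  move: comN; rewrite mulmxBl mulmxBr mul1mx mulmx1 -scalemxAl -scalemxAr.
  by move/addrI/oppr_inj/(scalerI e0).
move=> a b ab.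
(* With this formula [KD] says that the squared difference of the two block numbers times [X a b] is
   0. *)
have KE : K a b = ((reshape_index tau a)%:R - (reshape_index tau b)%:R) * X a b.
  rewrite /K /D /block_scalar_mx mul_mx_diag mul_diag_mx !mxE mulrBl.
  by rewrite (mulrC (X a b)).
clearbody K; have /matrixP/(_ a b)/eqP := KD.
rewrite mul_mx_diag mul_diag_mx !mxE KE -subr_eq0 [X in X - _]mulrC -mulrBl.
rewrite !mulf_eq0 !subr_eq0 !eqr_nat eq_sym (negPf ab) /=.
by rewrite eq_sym => /eqP.
Qed.

(** * Polynomials in a matrix, and grouping of indices *)

Lemma poly_chinese (F : fieldType) (I : eqType) (s : seq I)
    (q g : I -> {poly F}) :
  uniq s -> {in s &, forall i j, i != j -> coprimep (q i) (q j)} ->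
  exists f, {in s, forall i, q i %| f - g i}.
Proof.
elim: s => [|i s IHs] /=; first by exists 0.
move=> /andP[iNs us] cop.
have [f fq] : exists f, {in s, forall i, q i %| f - g i}.
  by apply: IHs => // j k js ks; apply: cop; rewrite inE ?js ?ks orbT.
have : coprimep (q i) (\prod_(j <- s) q j).
  rewrite coprimep_sym big_seq; elim/big_ind: _ => [|p r|j js].
  - exact: coprime1p.
  - by rewrite coprimepMl => -> ->.
  - apply: cop; rewrite ?inE ?eqxx ?js ?orbT//.
    by apply: contraNneq iNs => <-.
move=> /Bezout_eq1_coprimepP[[u v] /= uv1].
set Q := \prod_(j <- s) q j in uv1.
(* Modulo [q i] and [Q], the factor [u * q i] is 0 and 1, while [v * Q] is 1 and 0. *)
exists (f * (u * q i) + g i * (v * Q)) => j; rewrite inE => /predU1P[->|js].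
  rewrite -[X in _ - X]mulr1 -uv1 mulrDr opprD addrACA subrr addr0.
  by rewrite -mulrBl mulrA dvdp_mull.
have -> : f * (u * q i) + g i * (v * Q) - g j = (f - g j) + (g i - f) * v * Q.
  have -> : u * q i = 1 - v * Q by rewrite -uv1 addrK.
  by ring.
apply: dvdp_add; first exact: fq.
by rewrite dvdp_mull// /Q (big_rem j js)/= dvdp_mulr.
Qed.

(** Factors [Z] cross [A] one at a time, and the order reversed by transposition is immaterial for
    powers of [Z]. The null space is thus stable under polynomials. *)
Lemma horner_mx_adjoint (R : comNzRingType) (n : nat) (A Z : 'M[R]_n.+1)
    (f : {poly R}) :
  A *m Z = Z^T *m A -> A *m horner_mx Z f = (horner_mx Z f)^T *m A.
Proof.
move=> AZ; elim/poly_ind: f => [|f c IHf].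
  by rewrite rmorph0 mulmx0 trmx0 mul0mx.
rewrite rmorphD rmorphM /= horner_mx_X horner_mx_C mulmxDr linearD mulmxDl /=.
rewrite tr_scalar_mx scalar_mxC; congr (_ + _).
rewrite [LHS]mulmxA IHf -mulmxA AZ mulmxA -trmx_mul; congr (_^T *m _).
exact/comm_mx_horner.
Qed.

Lemma horner_mx_eigenvector (F : fieldType) (n : nat) (Z : 'M[F]_n.+1)
    (f : {poly F}) (v : 'rV[F]_n.+1) (l : F) :
  v *m Z = l *: v -> v *m horner_mx Z f = f.[l] *: v.
Proof.
move=> vZ; elim/poly_ind: f => [|f c IHf].
  by rewrite rmorph0 mulmx0 horner0 scale0r.
rewrite rmorphD rmorphM /= horner_mx_X horner_mx_C hornerMXaddC mulmxDr.
rewrite mul_mx_scalar scalerDl; congr (_ + _).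
by rewrite [LHS]mulmxA IHf -scalemxAl vZ scalerA.
Qed.

(** Listing the indices fibre by fibre makes every fibre of [d] a run of consecutive positions; the
    fibre sizes are the parts. *)
Lemma block_partition_of_fun (T : eqType) (n : nat) (d : 'I_n -> T) :
  exists (s : 'S_n) (tau : seq nat),
    [/\ is_partition n tau, size tau = size (undup (codom d))
      & forall a b : 'I_n, reshape_index tau a != reshape_index tau b ->
          d (s a) != d (s b)].
Proof.
case: n d => [|n] d.
  exists 1%g, [::]; split=> //.
  by rewrite (size0nil (_ : size (codom d) = 0%N))// size_codom card_ord.
pose l := [tuple d i | i < n.+1]; pose u := undup l.
pose ss := [seq nseq (count_mem x l) x | x <- u].
have /tuple_permP[s sE] : perm_eq (flatten ss) l by exact: perm_count_undup.
have tauE : shape ss = [seq count_mem x l | x <- u].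
  by rewrite /shape -map_comp; apply: eq_map => x /=; rewrite size_nseq.
have taun : sumn (shape ss) = n.+1.
  by rewrite -size_flatten (perm_size (perm_count_undup l)) size_tuple.
have lts (a : 'I_n.+1) : (reshape_index (shape ss) a < size u)%N.
  rewrite -[size u](size_map (fun x => count_mem x l)) -tauE.
  by rewrite reshape_indexP ?taun.
have dE (a : 'I_n.+1) : d (s a) = nth (d ord0) u (reshape_index (shape ss) a).
  transitivity (nth (d ord0) (flatten ss) a).
    rewrite sE (nth_map ord0) ?size_enum_ord// nth_ord_enum.
    by rewrite tnth_mktuple.
  rewrite nth_flatten (nth_map (d ord0)) ?lts// nth_nseq.
  have := @reshape_offsetP (shape ss) a; rewrite taun ltn_ord => /(_ isT).
  by rewrite {2}tauE (nth_map (d ord0)) ?lts// => ->.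
exists s, (shape ss); split.
- split=> //; rewrite tauE; apply/allP => k /mapP[x xu ->].
  by rewrite -has_count has_pred1 -mem_undup.
- by rewrite tauE size_map /u /codom.
- by move=> a b; rewrite !dE nth_uniq ?lts ?undup_uniq.
Qed.

(** * Eigenvalue groups and their real polynomials *)

Section EigenvalueQuadratic.
Context (R : realType).
Implicit Types l k : R[i].

Definition upper_eigenvalues (n : nat) (Z : 'M[R]_n) : seq R[i] :=
  [seq l <- eigenvalues Z | 0 <= complex.Im l].

Lemma size_zeta_opt (n : nat) (Z : 'M[R]_n) :
  size (zeta_opt Z) = size (upper_eigenvalues Z).
Proof. by rewrite !size_map. Qed.

(** For real [l] this is the square of a linear factor, so one formula serves both kinds of
    groups. *)
Definition conj_poly l : {poly R} :=
  ('X - (complex.Re l)%:P) ^+ 2 + (complex.Im l ^+ 2)%:P.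

Lemma map_conj_poly l :
  map_poly (real_complex R) (conj_poly l) = ('X - l%:P) * ('X - (conjc l)%:P).
Proof.
case: l => a b; rewrite /conj_poly /=.
rewrite rmorphD rmorphXn rmorphB /= map_polyX !map_polyC /=.
have -> : (a -i* b)%C = a%:C%C - b%:C%C * 'i%C by simpc.
have -> : (a +i* b)%C = a%:C%C + b%:C%C * 'i%C by simpc.
have -> : (b ^+ 2)%:C%C = - (b%:C%C * 'i%C) ^+ 2.
  by rewrite exprMn sqr_i rmorphXn mulrN1 opprK.
rewrite !(rmorphD, rmorphN) /= !rmorphXn /=; move: (b%:C%C * 'i%C)%:P => y.
by ring.
Qed.

Lemma coprimep_conj_poly l k :
  0 <= complex.Im l -> 0 <= complex.Im k -> l != k ->
  coprimep (conj_poly l) (conj_poly k).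
Proof.
move=> l0 k0 lk; rewrite -(coprimep_map (real_complex R)) !map_conj_poly.
(* If [l = conjc k], both imaginary parts, being nonnegative, vanish and [l = k]. *)
have lkc : l != conjc k.
  apply: contra_neq lk; case: l k l0 k0 => a b [c d] /= b0 d0 [-> bd].
  by congr (_ +i* _)%C; apply/eqP; rewrite eq_le; apply/andP; split;
    rewrite bd; rewrite bd in b0; rewrite ?(le_trans _ d0) ?oppr_le0//
      ?(le_trans _ b0) // -?oppr_ge0.
have lck : conjc l != k by rewrite -[k]conjcK (inj_eq (inv_inj (@conjcK R))).
rewrite coprimepMr !coprimep_XsubC !rootM !root_XsubC !negb_or.
rewrite ![k == _]eq_sym ![conjc k == _]eq_sym lk lkc lck/=.
by rewrite (inj_eq (inv_inj (@conjcK R))).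
Qed.

Lemma mem_upper_eigenvalues (n : nat) (Z : 'M[R]_n) l :
  eigenvalue (complex_mx Z) l ->
  (l \in upper_eigenvalues Z) || (conjc l \in upper_eigenvalues Z).
Proof.
rewrite -mem_eigenvalues !mem_filter conj_eigenvalues => ->; rewrite !andbT.
by case: l => a b /=; rewrite oppr_ge0 le_total.
Qed.

(** Each of the [n] complex linear factors divides the product over the groups, so the crude
    exponent [n] absorbs all multiplicities. *)
Lemma char_poly_dvdp_conj_poly (n : nat) (Z : 'M[R]_n) :
  char_poly Z %| (\prod_(l <- upper_eigenvalues Z) conj_poly l) ^+ n.
Proof.
rewrite -(dvdp_map (real_complex R)) map_char_poly rmorphXn rmorph_prod /=.
set Q := \prod_(_ <- _) _.
have [r rE] : exists r, char_poly (complex_mx Z) = \prod_(z <- r) ('X - z%:P).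
  have [r rE] := closed_field_poly_normal (char_poly (complex_mx Z)).
  by exists r; rewrite {1}rE (monicP (char_poly_monic _)) scale1r.
have sr : size r = n.
  by have := size_char_poly (complex_mx Z); rewrite rE size_prod_XsubC => -[].
have rQ : {in r, forall z, 'X - z%:P %| Q}.
  move=> z zr.
  have : eigenvalue (complex_mx Z) z.
    by rewrite eigenvalue_root_char rE root_prod_XsubC.
  move=> /mem_upper_eigenvalues/orP[] zZ; rewrite /Q (big_rem _ zZ) /=;
    rewrite map_conj_poly dvdp_mulr//; [rewrite dvdp_mulr//|].
  by rewrite conjcK dvdp_mull.
rewrite -/(complex_mx Z) rE; have -> : Q ^+ n = Q ^+ size r by rewrite sr.
elim: r rQ {rE sr} => [|z r IHr] rQ; first by rewrite big_nil dvd1p.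
rewrite big_cons exprS dvdp_mul ?rQ ?inE ?eqxx// IHr// => y yr.
by rewrite rQ// inE yr orbT.
Qed.

End EigenvalueQuadratic.

(** Members of one group share their real part, so eigenvalues with distinct real parts lie in
    distinct groups. *)
Lemma size_zeta_opt_ge (R : realType) (n : nat) (Z : 'M[R]_n) (s : seq R[i]) :
  all (eigenvalue (complex_mx Z)) s -> uniq (map (@complex.Re R) s) ->
  (size s <= size (zeta_opt Z))%N.
Proof.
move=> /allP sZ us; rewrite size_zeta_opt.
pose up (l : R[i]) := if 0 <= complex.Im l then l else conjc l.
have Re_up : map (@complex.Re R) (map up s) = map (@complex.Re R) s.
  by rewrite -map_comp; apply: eq_map => -[a b]; rewrite /= /up /=; case: ifP.
rewrite -(size_map up) uniq_leq_size//.
  by apply: (@map_uniq _ _ (@complex.Re R)); rewrite Re_up.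
move=> _ /mapP[l /sZ lZ ->]; rewrite mem_filter /up.
case: ifP => [->|/negbT]; first by rewrite mem_eigenvalues.
rewrite -ltNge conj_eigenvalues mem_eigenvalues [eigenvalue _ _]lZ andbT.
by case: l {lZ} => a b /= b0; rewrite oppr_ge0 ltW.
Qed.

(** The trace is the sum of the eigenvalues with multiplicity; being real, it is also the sum of
    their real parts. *)
Lemma mxtrace_Re_eigenvalue (R : realType) (n : nat) (Z : 'M[R]_n) (r : R) :
  (forall l, eigenvalue (complex_mx Z) l -> complex.Re l = r) ->
  \tr Z = n%:R * r.
Proof.
case: n Z => [|n] Z Zr; first by rewrite mul0r /mxtrace big_ord0.
have [s sE] : exists s, char_poly (complex_mx Z) = \prod_(z <- s) ('X - z%:P).
  have [s sE] := closed_field_poly_normal (char_poly (complex_mx Z)).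
  by exists s; rewrite {1}sE (monicP (char_poly_monic _)) scale1r.
have ss : size s = n.+1.
  by have := size_char_poly (complex_mx Z); rewrite sE size_prod_XsubC => -[].
have trE : (\tr Z)%:C%C = \sum_(z <- s) z.
  have := char_poly_trace (complex_mx Z) (ltn0Sn n).
  have := @coefPn_prod_XsubC _ s; rewrite ss -sE => -> // /oppr_inj ->.
  by rewrite trace_map_mx.
have -> : \tr Z = \sum_(z <- s) complex.Re z.
  rewrite -[LHS]/(complex.Re (\tr Z)%:C%C) trE.
  by apply: big_morph => // -[a b] [].
rewrite (eq_big_seq (fun=> r)) => [|z zs].
  by rewrite big_const_seq count_predT ss iter_addr_0 mulr_natl.
by apply: Zr; rewrite eigenvalue_root_char sE root_prod_XsubC.
Qed.

Lemma zeta_opt_conj (R : realType) (n : nat) (Z W : 'M[R]_n) :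
  W \in unitmx -> zeta_opt (invmx W *m Z *m W) = zeta_opt Z.
Proof.
move=> uW.
have chE :
    char_poly (complex_mx (invmx W *m Z *m W)) = char_poly (complex_mx Z).
  rewrite -!(map_char_poly (real_complex R)); congr map_poly.
  rewrite /char_poly /char_poly_mx.
  have -> : 'X%:M - map_mx polyC (invmx W *m Z *m W) =
     map_mx polyC (invmx W) *m ('X%:M - map_mx polyC Z) *m map_mx polyC W.
    rewrite !map_mxM mulmxBr mulmxBl scalar_mxC -[_%:M *m _ *m _]mulmxA.
    rewrite -[in RHS]map_mxM mulVmx//.
    by rewrite map_mx1 mulmx1.
  rewrite !det_mulmx mulrAC -det_mulmx -map_mxM mulVmx// map_mx1 det1 mul1r.
  by [].
by rewrite /zeta_opt /eigenvalue_groups /eigenvalues chE.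
Qed.

(** * Upper bound on the number of eigenvalue groups *)

Lemma separating_polynomial (R : realType) (n : nat) (Z : 'M[R]_n.+1) :
  exists f (P : 'M[R]_n.+1) (d : 'rV[R]_n.+1),
    [/\ P \in unitmx, P *m horner_mx Z f = diag_mx d *m P
      & (size (zeta_opt Z) <= size (undup (codom (d ord0))))%N].
Proof.
set ls := upper_eigenvalues Z.
have uls : uniq ls by rewrite filter_uniq// undup_uniq.
pose c l : R := (index l ls)%:R.
have [f fP] : exists f, {in ls, forall l,
    conj_poly l ^+ n.+1 %| f - (c l)%:P}.
  apply: poly_chinese => // l k.
  rewrite !mem_filter => /andP[l0 _] /andP[k0 _] lk.
  by rewrite coprimep_expl// coprimep_expr// coprimep_conj_poly.
pose Q := horner_mx Z f.
pose q : {poly R} := \prod_(x <- map c ls) ('X - x%:P).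
have ucs : uniq (map c ls).
  rewrite map_inj_in_uniq// => l k lls kls /eqP.
  by rewrite eqr_nat => /eqP; exact: index_inj.
have Qq : horner_mx Q q = 0.
  have -> : horner_mx Q q = horner_mx Z (\prod_(l <- ls) (f - (c l)%:P)).
    rewrite /q big_map !rmorph_prod; apply: eq_bigr => l _.
    by rewrite !rmorphB /= horner_mx_X !horner_mx_C.
  (* The moduli of [f] carry the exponent [n.+1] so that this divisibility holds; Cayley-Hamilton
     then makes [q] annihilate [Q]. *)
  have /dvdpP[g ->] : char_poly Z %| \prod_(l <- ls) (f - (c l)%:P).
    apply: dvdp_trans (char_poly_dvdp_conj_poly Z) _.
    rewrite -/ls -prodrXl big_seq [X in _ %| X]big_seq.
    by elim/big_rec2: _ => // l p r /fP lf pr; exact: dvdp_mul.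
  by rewrite rmorphM /= Cayley_Hamilton mulr0.
have /diagonalizableP[P uP /similar_diagPex[d /(similarP uP) Pd]] :
    exists2 rs, uniq rs & mxminpoly Q %| \prod_(x <- rs) ('X - x%:P).
  by exists (map c ls) => //; exact: mxminpoly_min.
exists f, P, d; split=> //.
rewrite size_zeta_opt -(size_map c) uniq_leq_size// => _ /mapP[l lls ->].
rewrite mem_undup.
(* Modulo ['X - l] the polynomial [f] is [c l], so a complex eigenvector of [Z] for [l] is one of
   [Q] for the real number [c l]. *)
have /eigenvalueP[v vQ v0] : eigenvalue Q (c l).
  rewrite -(eigenvalue_map (real_complex R)).
  have : eigenvalue (complex_mx Z) l.
    by move: lls; rewrite mem_filter mem_eigenvalues => /andP[].
  move=> /eigenvalueP[v vZ v0]; apply/eigenvalueP; exists v => //.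
  rewrite map_horner_mx (horner_mx_eigenvector _ vZ); congr (_ *: _).
  have := fP _ lls; rewrite -(dvdp_map (real_complex R)) rmorphXn rmorphB /=.
  rewrite map_polyC map_conj_poly exprS -mulrA.
  move=> /(dvdp_trans (dvdp_mulr _ (dvdpp _))).
  by rewrite dvdp_XsubCl rootE hornerD hornerN hornerC subr_eq0 => /eqP.
have : v *m invmx P *m diag_mx d = c l *: (v *m invmx P).
  have -> : diag_mx d = P *m Q *m invmx P by rewrite Pd mulmxK.
  by rewrite !mulmxA mulmxKV// vQ -scalemxAl.
have : v *m invmx P != 0.
  by apply: contra_neq v0 => vP; rewrite -[v](mulmxKV uP) vP mul0mx.
move: (v *m invmx P) => u /rV0Pn[a ua] /rowP/(_ a).
rewrite mul_mx_diag !mxE mulrC => /(mulIf ua) <-; exact: codom_f.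
Qed.

Lemma zeta_opt_jbd (R : realType) (m n : nat) (A : 'I_m -> 'M[R]_n.+1)
    (Z : 'M[R]_n.+1) : Z \in null_space A ->
  exists tau W, [/\ is_partition n.+1 tau, jbd_solution A tau W
                  & (size (zeta_opt Z) <= size tau)%N].
Proof.
move=> /null_spaceP AZ.
have [f [P [d [uP Pd zd]]]] := separating_polynomial Z.
have [s [tau [ptau stau bd]]] := block_partition_of_fun (d ord0).
(* The columns of [invmx P] are an eigenbasis of [horner_mx Z f]; the permutation makes equal
   eigenvalues adjacent. *)
exists tau, (invmx P *m perm_mx s^-1); split=> //; last by rewrite stau.
split; first by rewrite unitmx_mul unitmx_inv uP unitmx_perm.
move=> i a b /bd dab.
set B := (invmx P)^T *m A i *m invmx P.
have -> : (invmx P *m perm_mx s^-1)^T *m A i *m (invmx P *m perm_mx s^-1) =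
    col_perm s (row_perm s B).
  by rewrite trmx_mul tr_perm_mx invgK col_permE row_permE !mulmxA.
(* As [horner_mx Z f] satisfies the null space equations, [B] commutes with [diag_mx d] and vanishes
   between different eigenvalues. *)
have /null_space_conj := horner_mx_adjoint f (AZ i).
move=> /(_ (invmx P)); rewrite unitmx_inv invmxK Pd mulmxK// => /(_ uP).
rewrite tr_diag_mx -/B => /matrixP/(_ (s a) (s b)).
clearbody B; rewrite mul_mx_diag mul_diag_mx !mxE => /eqP.
rewrite mulrC -subr_eq0 -mulrBl mulf_eq0 subr_eq0 eq_sym (negPf dab) /=.
by move/eqP.
Qed.

(** * Spectra of single diagonal blocks *)

Section BlockEigenvalues.
Context (R : realType) (n : nat) (tau : seq nat).
Implicit Types (X : 'M[R]_n) (c : nat -> R) (j : nat) (l : R[i]).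

(** For block diagonal [X] this means an eigenvalue of the [j]-th block; full-length eigenvectors
    supported there avoid submatrices of varying size. *)
Definition block_eigenvalue X j l : Prop :=
  exists v : 'rV[R[i]]_n, [/\ v != 0,
    forall a : 'I_n, reshape_index tau a != j -> v ord0 a = 0
    & v *m complex_mx X = l *: v].

Definition isolate_block X j c : 'M[R]_n :=
  \matrix_(a, b) if reshape_index tau a == j then X a b
                 else c (reshape_index tau a) *+ (a == b).

Definition block_size j : nat := #|[pred a : 'I_n | reshape_index tau a == j]|.

Definition block_trace X j : R := \sum_(a < n | reshape_index tau a == j) X a a.

Definition block_mean X j : R := block_trace X j / (block_size j)%:R.

Lemma block_eigenvalue_isolate X j c l :
  block_eigenvalue X j l -> eigenvalue (complex_mx (isolate_block X j c)) l.
Proof.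
move=> [v [v0 vj vX]]; apply/eigenvalueP; exists v => //.
rewrite -vX; apply/rowP => b; rewrite !mxE; apply: eq_bigr => a _.
by rewrite !mxE; case: eqP => // /eqP/vj ->; rewrite !mul0r.
Qed.

Lemma scalar_eigenvalue_isolate X j c (a : 'I_n) :
  reshape_index tau a != j ->
  eigenvalue (complex_mx (isolate_block X j c)) (c (reshape_index tau a))%:C%C.
Proof.
move=> aj; rewrite eigenvalue_map; apply/eigenvalueP; exists (delta_mx 0 a).
  apply/rowP => b; rewrite -rowE !mxE eqxx (negPf aj) /= [b == a]eq_sym.
  by rewrite mulr_natr.
apply/eqP => /rowP/(_ a)/eqP; rewrite !mxE !eqxx.
exact/negP/oner_neq0.
Qed.

(** At an index [a] outside block [j] the eigenvector equation reads [r * v_a = l * v_a], so for [l]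
    other than [r] the eigenvector is supported on the block. *)
Lemma eigenvalue_isolate_block X j (r : R) l : block_diagonal tau X ->
  eigenvalue (complex_mx (isolate_block X j (fun=> r))) l ->
  l = r%:C%C \/ block_eigenvalue X j l.
Proof.
move=> bX /eigenvalueP[v vY v0].
have [->|lr] := eqVneq l r%:C%C; [by left|right].
have vj (a : 'I_n) : reshape_index tau a != j -> v ord0 a = 0.
  move=> aj; have /rowP/(_ a) := vY; rewrite !mxE (bigD1 a)//= !mxE (negPf aj).
  rewrite eqxx big1 => [|b ba].
    by move/eqP; rewrite addr0 mulrC -subr_eq0 -mulrBl mulf_eq0 subr_eq0 eq_sym
      (negPf lr) => /eqP.
  rewrite !mxE; case: eqP => bj; last by rewrite (negPf ba) mulr0n mulr0.
  by rewrite bX ?mulr0// bj eq_sym.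
exists v; split=> //; rewrite -vY; apply/rowP => b; rewrite !mxE.
apply: eq_bigr => a _.
by rewrite !mxE; case: eqP => // /eqP/vj ->; rewrite !mul0r.
Qed.

(** Filling the other blocks with [r] itself gives all eigenvalues real part [r]; in the trace, the
    filled diagonal entries then cancel. *)
Lemma block_trace_eigenvalue X j (r : R) : block_diagonal tau X ->
  (forall l, block_eigenvalue X j l -> complex.Re l = r) ->
  block_trace X j = (block_size j)%:R * r.
Proof.
move=> bX Xr.
have trY : \tr (isolate_block X j (fun=> r)) = n%:R * r.
  apply: mxtrace_Re_eigenvalue => l /(eigenvalue_isolate_block bX)[->//|].
  exact: Xr.
have : \sum_(a < n) (isolate_block X j (fun=> r) a a - r) = 0.
  rewrite sumrB -/(\tr _) trY sumr_const card_ord mulr_natl subrr//.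
rewrite (bigID (fun a : 'I_n => reshape_index tau a == j))/=.
rewrite [X in _ + X]big1 ?addr0 => [|a aj]; last first.
  by rewrite mxE (negPf aj) eqxx subrr.
rewrite sumrB sumr_const mulr_natl => /eqP; rewrite subr_eq0 => /eqP <-.
by apply: eq_bigr => a aj; rewrite mxE aj.
Qed.

(** With no eigenvalue at all, the trace formula would hold vacuously for every [r]; the values 0
    and 1 contradict each other. *)
Lemma block_eigenvalue_exists X j : block_diagonal tau X ->
  (0 < block_size j)%N -> exists l, block_eigenvalue X j l.
Proof.
move=> bX j0; apply/not_existsP => Xl.
have E r : block_trace X j = (block_size j)%:R * r.
  by apply: block_trace_eigenvalue => // l /Xl.
have := E 1; rewrite (E 0) mulr0 mulr1 => /esym/eqP.
by rewrite pnatr_eq0 eqn0Ngt j0.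
Qed.

(** The isolated matrix is [X] cut down to one block plus a block scalar matrix, and block scalars
    commute with [B] and [X]. *)
Lemma isolate_block_adjoint (B X : 'M[R]_n) j c :
  block_diagonal tau B -> block_diagonal tau X -> B *m X = X^T *m B ->
  B *m isolate_block X j c = (isolate_block X j c)^T *m B.
Proof.
move=> bB bX BX; set Y := isolate_block X j c.
pose diag := @block_scalar_mx R n tau.
have diagC g M : block_diagonal tau M -> M *m diag g = diag g *m M.
  exact: block_diagonal_scalarC.
have -> : Y = diag (fun k => (k == j)%:R) *m X +
    diag (fun k => if k == j then 0 else c k).
  apply/matrixP => a b; rewrite mul_diag_mx !mxE.
  by case: eqP; rewrite ?mul1r ?mul0r ?add0r// mul0rn addr0.
rewrite mulmxDr [in RHS]linearD /= trmx_mul !tr_diag_mx mulmxDl.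
congr (_ + _); last exact: diagC.
by rewrite -(diagC _ X)// mulmxA BX -!mulmxA diagC.
Qed.

End BlockEigenvalues.

Lemma block_size_gt0 (n : nat) (tau : seq nat) (j : 'I_(size tau)) :
  is_partition n tau -> (0 < block_size n tau j)%N.
Proof.
move=> /(reshape_index_onto j)[a aj].
by apply/card_gt0P; exists a; rewrite inE aj.
Qed.

(* Otherwise isolating the j-th block would produce more than [size tau]
   eigenvalue groups. *)
Lemma block_eigenvalue_Re_eq (R : realType) (n : nat) (tau : seq nat)
    (X : 'M[R]_n) (j : 'I_(size tau)) (l k : R[i]) :
  is_partition n tau ->
  (forall c, (size (zeta_opt (isolate_block tau X j c)) <= size tau)%N) ->
  block_eigenvalue tau X j l -> block_eigenvalue tau X j k ->
  complex.Re l = complex.Re k.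
Proof.
move=> ptau maxX jl jk; apply/eqP/negP => /negP lk.
pose M := `|complex.Re l| + `|complex.Re k| + 1.
pose c i : R := M + i%:R.
have Mc i : M <= c i by rewrite lerDl.
have ltM x : `|x| <= `|complex.Re l| + `|complex.Re k| -> forall i, x != c i.
  move=> xM i; rewrite lt_eqF// (le_lt_trans (ler_norm x))//.
  by rewrite (lt_le_trans _ (Mc i))// (le_lt_trans xM)// ltrDl.
have lc i : complex.Re l != c i by rewrite ltM// lerDl.
have kc i : complex.Re k != c i by rewrite ltM// lerDr.
(* Two eigenvalues from block [j] and one from each other block: one more than [size tau]. The
   choice of [c] keeps their real parts distinct. *)
pose s := [:: l, k & [seq (c i)%:C%C | i <- rem (j : nat) (iota 0 (size tau))]].
have : (size s <= size (zeta_opt (isolate_block tau X j c)))%N.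
  apply: size_zeta_opt_ge.
    rewrite /= !block_eigenvalue_isolate//=; apply/allP => _ /mapP[i + ->].
    rewrite mem_rem_uniq ?iota_uniq// !inE mem_iota add0n => /andP[ij it].
    have [a ai] := @reshape_index_onto _ _ (Ordinal it) ptau.
    by have := @scalar_eigenvalue_isolate _ _ tau X j c a; rewrite ai; apply.
  rewrite /= !inE (negPf lk) /= -map_comp.
  have cN x : (forall i, x != c i) ->
      x \notin map c (rem (j : nat) (iota 0 (size tau))).
    by move=> xc; apply/mapP => -[i _ xi]; have := xc i; rewrite -xi eqxx.
  rewrite !cN//= map_inj_uniq ?rem_uniq ?iota_uniq// => i i' /addrI/eqP.
  by rewrite eqr_nat => /eqP.
move=> /leq_trans/(_ (maxX c)).
rewrite /= size_map size_rem ?mem_iota//= size_iota prednK ?ltnn//.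
exact: leq_ltn_trans (ltn_ord j).
Qed.

Lemma block_eigenvalue_mean (R : realType) (n : nat) (tau : seq nat)
    (X : 'M[R]_n) (j : 'I_(size tau)) :
  is_partition n tau -> block_diagonal tau X ->
  (forall c, (size (zeta_opt (isolate_block tau X j c)) <= size tau)%N) ->
  exists l, block_eigenvalue tau X j l /\
    complex.Re l = block_mean tau X j.
Proof.
move=> ptau bX maxX; have j0 := block_size_gt0 j ptau.
have [l jl] := block_eigenvalue_exists bX j0; exists l.
split=> //; rewrite /block_mean (block_trace_eigenvalue bX (r := complex.Re l)).
  by rewrite mulrAC divff ?mul1r// pnatr_eq0 -lt0n.
by move=> k jk; exact: (block_eigenvalue_Re_eq ptau maxX).
Qed.

(** One eigenvalue is picked in each block; its real part is the block mean, so distinct means give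
    distinct groups. *)
Lemma size_zeta_opt_ge_blocks (R : realType) (n : nat) (tau : seq nat)
    (X : 'M[R]_n) :
  is_partition n tau -> block_diagonal tau X ->
  (forall j c, (size (zeta_opt (isolate_block tau X j c)) <= size tau)%N) ->
  injective (fun j : 'I_(size tau) => block_mean tau X j) ->
  (size tau <= size (zeta_opt X))%N.
Proof.
move=> ptau bX maxX inj.
have [l lP] := choice (fun j : 'I_(size tau) =>
  block_eigenvalue_mean ptau bX (maxX j)).
have <- : size (codom l) = size tau by rewrite size_codom card_ord.
apply: size_zeta_opt_ge.
  apply/allP => _ /codomP[j ->].
  have [[v [v0 _ vX]] _] := lP j.
  by apply/eigenvalueP; exists v.
rewrite codomE -map_comp map_inj_uniq ?enum_uniq// => j k /=.
have [_ ->] := lP j; have [_ ->] := lP k.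
exact: inj.
Qed.

(** * Proper hyperplanes as null sets *)

Lemma measurable_tuple_hyperplane (R : realType) (k : nat) (c : 'I_k -> R) :
  measurable ([set x | \sum_i tnth x i * c i = 0]%classic
              : set (k.-tuple (measurableTypeR R))).
Proof.
pose f (x : k.-tuple (measurableTypeR R)) : measurableTypeR R :=
  \sum_i tnth x i * c i.
have mf : measurable_fun setT f.
  apply: measurable_sum => i; apply: measurable_realfun.measurable_funM => //.
  exact: measurable_tnth.
have := mf measurableT [set 0]%classic (measurable_set1 0).
by rewrite setTI.
Qed.

Lemma lebesgue_tuple_hyperplane (R : realType) (k : nat) (c : 'I_k -> R) :
  (exists i, c i != 0) ->
  lebesgue_tuple R k [set x | \sum_i tnth x i * c i = 0]%classic = 0%E.
Proof.
elim: k c => [|k IHk] c [i ci]; first by case: i ci.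
rewrite /lebesgue_tuple /= /measure_cons /pushforward.
set H := (X in product_measure1 _ _ X).
have mH : measurable H.
  rewrite -[H]setTI; apply: measurable_tuple_cons => //.
  exact: measurable_tuple_hyperplane.
have HE x u : H (x, u) <-> x * c ord0 + \sum_j tnth u j * c (lift ord0 j) = 0.
  rewrite /H /preimage /mkset big_ord_recl /=.
  by under eq_bigr do rewrite tnthS.
have [c0|c0] := eqVneq (c ord0) 0.
  have {ci} [j cj] : exists j, c (lift ord0 j) != 0.
    case: (unliftP ord0 i) ci => [j ->|->] ci; first by exists j.
    by rewrite c0 eqxx in ci.
  apply: integral0_eq => x _ /=.
  rewrite -[RHS](IHk (fun j => c (lift ord0 j))); last by exists j.
  congr (power_measure _ _ _); apply/seteqP; split => u;
    rewrite /xsection /= inE HE c0 mulr0 add0r //.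
(* For nonzero [c ord0] the sections at a fixed first coordinate need not pass through 0, so the
   other order of integration is used: at fixed remaining coordinates the section is one point. *)
rewrite (@product_measure_unique _ _ _ _ _ _ _
  (product_measure2 lebesgue_measure (power_measure lebesgue_measure k)))//;
  last by move=> B D mB mD; exact: product_measure2E.
apply: integral0_eq => u _ /=.
rewrite -(lebesgue_measure_set1
  (- (\sum_j tnth u j * c (lift ord0 j)) / c ord0)).
congr (lebesgue_measure _); apply/seteqP; split => x;
  rewrite /ysection /= inE HE.
  by move/eqP; rewrite addr_eq0 => /eqP <-; rewrite mulfK.
by move->; rewrite divfK// addNr.
Qed.

(** In coordinates the zero set is a hyperplane whose coefficients [phi (tnth b i)] do not all
    vanish. *)
Lemma ae_linear_functional_neq0 (R : realType) (E : vectType R) (V : {vspace E})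
    (phi : {linear E -> R^o}) :
  (exists2 v, v \in V & phi v != 0) -> ae_vspace V (fun v => phi v != 0).
Proof.
move=> [v vV phiv] b bV.
exists [set x | \sum_i tnth x i * phi (tnth b i) = 0]%classic; split.
- exact: measurable_tuple_hyperplane.
- apply: lebesgue_tuple_hyperplane; apply/not_existsP => phi0.
  move/eqP: phiv; apply; rewrite (coord_basis bV vV) linear_sum big1// => i _.
  rewrite linearZ /= -tnth_nth; have /negP/negPn/eqP-> := phi0 i.
  by rewrite scaler0.
- move=> x /= /negP/negPn/eqP; rewrite linear_sum => phix.
  rewrite -[RHS]phix; apply: eq_bigr => i _; by rewrite linearZ.
Qed.

Lemma ae_vspace_imp (R : realType) (E : vectType R) (V : {vspace E})
    (P Q : E -> Prop) :
  (forall v, v \in V -> P v -> Q v) -> ae_vspace V P -> ae_vspace V Q.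
Proof.
move=> PQ aeP b bV.
apply: (@filterS _ _ (ae_filter_ringOfSetsType _)) (aeP b bV) => x; apply: PQ.
by apply: rpred_sum => i _; apply: rpredZ; rewrite (basis_mem bV) ?mem_tnth.
Qed.

Lemma ae_vspace_forall (R : realType) (E : vectType R) (V : {vspace E})
    (I : finType) (P : I -> E -> Prop) :
  (forall i, ae_vspace V (P i)) -> ae_vspace V (fun v => forall i, P i v).
Proof.
move=> aeP b bV.
apply: (@filter_forall _ _ _ _ (ae_filter_ringOfSetsType _)) => i.
exact: aeP.
Qed.

(** * Separation of the block means *)

Lemma block_mean_linear (R : realType) (n : nat) (tau : seq nat)
    (j : nat) : scalar (fun X : 'M[R]_n => block_mean tau X j).
Proof.
move=> a X Y; rewrite /block_mean mulrA -mulrDl; congr (_ * _).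
rewrite /block_trace big_distrr -big_split /=.
by apply: eq_bigr => b _; rewrite !mxE.
Qed.

Lemma block_mean_scalar (R : realType) (n : nat) (tau : seq nat)
    (g : nat -> R) (j : 'I_(size tau)) : is_partition n tau ->
  block_mean tau (block_scalar_mx n tau g) j = g j.
Proof.
move=> ptau; rewrite /block_mean /block_trace (eq_bigr (fun=> g j)) => [|a].
  rewrite sumr_const -[X in X / _]mulr_natr mulfK//.
  by rewrite pnatr_eq0 -lt0n block_size_gt0.
by move=> /eqP aj; rewrite !mxE eqxx aj.
Qed.

Theorem theorem2p6 (R : realType) (m n : nat) (hn : (0 < n)%N)
    (A : 'I_m -> 'M[R]_n)
    (hA : forall (tau1 tau2 : seq nat) (W1 W2 : 'M[R]_n),
        gjbd_solution A tau1 W1 -> gjbd_solution A tau2 W2 ->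
        equivalent_solutions tau1 W1 tau2 W2) :
  ae_vspace (null_space A) (fun Z : 'M[R]_n => zeta_null_space A (zeta_opt Z)).
Proof.
have [tau [W sol]] := gjbd_solution_exists A hn.
case: n hn A hA W sol => // n _ A hA W sol.
have [ptau [uW bB] maxtau] := sol.
have maxZ Z : Z \in null_space A -> (size (zeta_opt Z) <= size tau)%N.
  move=> /zeta_opt_jbd[tau' [W' [ptau' sol' /leq_trans]]]; apply.
  exact: maxtau ptau' sol'.
have conjK Y : invmx W *m (W *m Y *m invmx W) *m W = Y.
  by rewrite !mulmxA mulVmx// mul1mx mulmxKV.
have nullY Y : (forall i, W^T *m A i *m W *m Y = Y^T *m (W^T *m A i *m W)) ->
    W *m Y *m invmx W \in null_space A.
  move=> BY; apply/null_spaceP => i.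
  have := null_space_conj (W := invmx W) _ (BY i).
  rewrite unitmx_inv invmxK => /(_ uW).
  have -> : (invmx W)^T *m (W^T *m A i *m W) *m invmx W = A i.
    by rewrite !mulmxA mulmxK// -trmx_mul mulmxV// trmx1 mul1mx.
  by [].
pose mean j Z := block_mean tau (invmx W *m Z *m W) j.
pose phi (p : 'I_(size tau) * 'I_(size tau)) (Z : 'M[R]_n.+1) : R^o :=
  mean p.1 Z - mean p.2 Z.
have phi_linear p : linear (phi p).
  move=> a Y Z; rewrite /phi /mean mulmxDr mulmxDl -scalemxAr -scalemxAl.
  rewrite !block_mean_linear; rewrite scalerBr opprD addrACA.
  by [].
have aephi : ae_vspace (null_space A)
    (fun Z => forall p, p.1 != p.2 -> phi p Z != 0).
  apply: ae_vspace_forall => p.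
  have [p12|p12] := eqVneq p.1 p.2.
    by move=> b bV; apply: aeW.
  pose L := GRing.isLinear.Build _ _ _ _ (phi p) (phi_linear p).
  pose phil : {linear 'M[R]_n.+1 -> R^o} := HB.pack (phi p) L.
  apply: (@ae_vspace_imp _ _ _ (fun Z => phil Z != 0)) => [//|].
  apply: ae_linear_functional_neq0.
  (* Block scalar matrices commute with the block diagonal forms of [A], so this lies in the null
     space; its block means are the block numbers. *)
  exists (W *m block_scalar_mx n.+1 tau (fun k => k%:R) *m invmx W).
    apply: nullY => i; rewrite tr_diag_mx.
    exact: block_diagonal_scalarC.
  rewrite /phil /= /phi /mean conjK !block_mean_scalar//.
  by rewrite subr_eq0 eqr_nat.
apply: ae_vspace_imp aephi => Z ZA phiZ.
exists Z => //; split=> // Z' /maxZ /leq_trans; apply.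
have bX : block_diagonal tau (invmx W *m Z *m W).
  by apply: (null_space_block_diagonal _ sol ZA) => W'; exact: hA.
rewrite -(zeta_opt_conj Z uW); apply: size_zeta_opt_ge_blocks => //.
  (* Isolated matrices, conjugated back by [W], remain in the null space, where [maxZ] bounds the
     number of groups. *)
  move=> j c; rewrite -[isolate_block _ _ _ _]conjK zeta_opt_conj//.
  apply/maxZ/nullY => i; apply: isolate_block_adjoint => //.
  by apply: null_space_conj => //; move/null_spaceP: ZA.
move=> j k /eqP jk; apply/eqP; apply: contraT => /(phiZ (j, k)).
by rewrite subr_eq0 => /negP[].
Qed.
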